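(* Every twisted product Finsler manifold $(M_1\times_fM_2,F)$ with isotropic mean Berwald curvature is a weakly Berwald manifold.
   Context: Let $(M_1,F_1)$, $(M_2,F_2)$ be Finsler manifolds (metrics smooth on the slit tangent bundle, positively 1-homogeneous on fibres, with positive definite fundamental tensor) and $f:M_1\times M_2\to\mathbb{R}^+$ smooth. The twisted product $M_1\times_f M_2$ is $M=M_1\times M_2$ with $F=\sqrt{F_1^2(x,y)+f^2(x,u)F_2^2(u,v)}$, considered where $y\in T_xM_1$, $v\in T_uM_2$ are both nonzero. For a Finsler metric $F$ on an $n$-dimensional manifold $M$ with local coordinates $x^i$ and fibre coordinates $y^i$, $g_{ij}=\frac12(F^2)_{y^iy^j}$, the spray coefficients are $G^i=\frac14g^{il}\big(\frac{\partial^2F^2}{\partial x^k\partial y^l}y^k-\frac{\partial F^2}{\partial x^l}\big)$, Berwald curvature $B^i_{\ jkl}=\frac{\partial^3G^i}{\partial y^j\partial y^k\partial y^l}$, mean Berwald curvature $E_{jk}=\frac12B^m_{\ jkm}$. $F$ is weakly Berwald if $E_{jk}=0$. $F$ has isotropic mean Berwald curvature if $E_{ij}=\frac12(n+1)cF^{-1}h_{ij}$ for some scalar function $c=c(x)$ on $M$, where $h_{ij}=FF_{y^iy^j}$ is the angular metric. *)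

(* Defs.v *)
From HB Require Import structures.
From mathcomp Require Import all_boot all_order all_algebra.
From mathcomp Require Import all_classical all_reals all_analysis.

Set Implicit Arguments.
Unset Strict Implicit.
Unset Printing Implicit Defensive.

Import Order.TTheory GRing.Theory Num.Theory.
Import numFieldNormedType.Exports.

Local Open Scope classical_set_scope.
Local Open Scope ring_scope.

Section smooth.
Context {R : realType} {V W : normedModType R}.

(* Meant for [U] open; in finite dimension this is the usual class C^k:
   [f] is C^(k+1) iff it is differentiable with C^k directional derivatives. *)
Fixpoint Ck (k : nat) (U : set V) (f : V -> W) : Prop :=
  if k is k'.+1 then
    (forall x, U x -> differentiable f x) /\ (forall v, Ck k' U ('D_v f))
  else forall x, U x -> {for x, continuous f}.

Definition smooth_on (U : set V) (f : V -> W) := forall k, Ck k U f.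

End smooth.

(* Charts are total functions, meaningful on [chart_dom i] only; likewise
   [chart_inv i] is meaningful on the image of [chart_dom i] only.
   [chart_at p] is a preferred chart around [p]; it is used to represent the
   tangent space at [p], see [to_tangent]. *)
Record manifold (R : realType) (n : nat) := Manifold {
  points :> topologicalType ;
  manifold_hausdorff : hausdorff_space points ;
  manifold_second_countable : @second_countable points ;
  charts : Type ;
  chart_dom : charts -> set points ;
  chart : charts -> points -> 'rV[R]_n ;
  chart_inv : charts -> 'rV[R]_n -> points ;
  chart_at : points -> charts ;
  chart_atP : forall p, chart_dom (chart_at p) p ;
  chart_domO : forall i, open (chart_dom i) ;
  chart_imageO : forall i, open (chart i @` chart_dom i) ;
  chartK : forall i p, chart_dom i p -> chart_inv i (chart i p) = p ;
  chart_continuous : forall i p, chart_dom i p -> {for p, continuous (chart i)} ;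
  chart_inv_continuous : forall i x, (chart i @` chart_dom i) x ->
    {for x, continuous (chart_inv i)} ;
  transition_smooth : forall i j,
    smooth_on (chart i @` (chart_dom i `&` chart_dom j)) (chart j \o chart_inv i)
}.

Arguments chart_dom {R n m} : rename.
Arguments chart {R n m} : rename.
Arguments chart_inv {R n m} : rename.
Arguments chart_at {R n m} : rename.

Section manifold_theory.
Context {R : realType} {n : nat} {M : manifold R n}.

Definition chart_image (i : charts M) : set 'rV[R]_n := chart i @` chart_dom i.

Definition transition (i j : charts M) : 'rV[R]_n -> 'rV[R]_n :=
  chart j \o chart_inv i.

Definition smooth_function (f : M -> R) :=
  forall i : charts M, smooth_on (chart_image i) (f \o chart_inv i).

(* The tangent space at [p] is R^n, a tangent vector being given by its
   components in the chart [chart_at p].  [to_tangent i x y] is the tangent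
   vector at the point of coordinates [x] in the chart [i] whose components in
   the chart [i] are [y]. *)
Definition to_tangent (i : charts M) (x y : 'rV[R]_n) : 'rV[R]_n :=
  'd (transition i (chart_at (chart_inv i x))) x y.

(* A function on the tangent bundle, expressed in the coordinates [(x, y)]
   induced by the chart [i]. *)
Definition local_expr (F : M -> 'rV[R]_n -> R) (i : charts M) (x y : 'rV[R]_n) : R :=
  F (chart_inv i x) (to_tangent i x y).

End manifold_theory.

Section local_finsler.
Context {R : realType} {n : nat}.
Implicit Types (F G : 'rV[R]_n -> 'rV[R]_n -> R) (x y : 'rV[R]_n) (i j k l : 'I_n).

Definition dx k G x y : R := 'D_(delta_mx 0 k) (G ^~ y) x.
Definition dy k G x y : R := 'D_(delta_mx 0 k) (G x) y.

Definition sq F x y : R := F x y ^+ 2.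

Definition fundamental_tensor F x y : 'M[R]_n :=
  \matrix_(i, j) (2^-1 * dy j (dy i (sq F)) x y).

Definition spray F i x y : R :=
  4^-1 * \sum_l invmx (fundamental_tensor F x y) i l *
    (\sum_k dx k (dy l (sq F)) x y * y 0 k - dx l (sq F) x y).

Definition berwald F i j k l x y : R := dy l (dy k (dy j (spray F i))) x y.

Definition mean_berwald F j k x y : R := 2^-1 * \sum_m berwald F m j k m x y.

Definition angular_metric F i j x y : R := F x y * dy j (dy i F) x y.

End local_finsler.

Section finsler.
Context {R : realType} {n : nat} {M : manifold R n}.

Record finsler_metric (F : M -> 'rV[R]_n -> R) : Prop := FinslerMetric {
  finsler_ge0 : forall p y, 0 <= F p y ;
  finsler_homogeneous : forall p (t : R) y, 0 < t -> F p (t *: y) = t * F p y ;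
  finsler_smooth : forall i : charts M,
    smooth_on (chart_image i `*` [set y : 'rV[R]_n | y != 0])
      (fun z : 'rV[R]_n * 'rV[R]_n => local_expr F i z.1 z.2) ;
  finsler_posdef : forall (i : charts M) (x y v : 'rV[R]_n),
    chart_image i x -> y != 0 -> v != 0 ->
    0 < (v *m fundamental_tensor (local_expr F i) x y *m v^T) 0 0
}.

(* [D p] is the set of the tangent vectors at [p] where the metric is
   considered; it is the set of nonzero vectors for a Finsler metric, but it is
   smaller for a twisted product. *)
Definition weakly_berwald (D : forall p : M, set 'rV[R]_n) (F : M -> 'rV[R]_n -> R) :=
  forall (i : charts M) (x y : 'rV[R]_n),
    chart_image i x -> D (chart_inv i x) (to_tangent i x y) ->
  forall j k : 'I_n, mean_berwald (local_expr F i) j k x y = 0.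

Definition isotropic_mean_berwald (D : forall p : M, set 'rV[R]_n)
    (F : M -> 'rV[R]_n -> R) :=
  exists c : M -> R, forall (i : charts M) (x y : 'rV[R]_n),
    chart_image i x -> D (chart_inv i x) (to_tangent i x y) ->
  forall j k : 'I_n, mean_berwald (local_expr F i) j k x y =
    2^-1 * (n + 1)%:R * c (chart_inv i x) * (local_expr F i x y)^-1 *
    angular_metric (local_expr F i) j k x y.

End finsler.

Section product_manifold.
Context {R : realType} {n1 n2 : nat}.
Variables (M1 : manifold R n1) (M2 : manifold R n2).

Local Notation pt := (M1 * M2)%type.
Local Notation ix := (charts M1 * charts M2)%type.

Definition prod_dom (i : ix) : set pt := chart_dom i.1 `*` chart_dom i.2.
Definition prod_chart (i : ix) (p : pt) : 'rV[R]_(n1 + n2) :=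
  row_mx (chart i.1 p.1) (chart i.2 p.2).
Definition prod_inv (i : ix) (z : 'rV[R]_(n1 + n2)) : pt :=
  (chart_inv i.1 (lsubmx z), chart_inv i.2 (rsubmx z)).
Definition prod_chart_at (p : pt) : ix := (chart_at p.1, chart_at p.2).

Lemma prod_hausdorff : hausdorff_space pt.
Proof.
move=> [p1 p2] [q1 q2] pq; congr (_, _).
- apply: (@manifold_hausdorff _ _ M1) => A B pA qB.
  have [|| [a b] [] [/= Aa _] [/= Ba _]] := pq (A `*` setT) (B `*` setT).
  + by exists (A, setT) => //; split => //; exact: filterT.
  + by exists (B, setT) => //; split => //; exact: filterT.
  + by exists a.
- apply: (@manifold_hausdorff _ _ M2) => A B pA qB.
  have [|| [a b] [] [/= _ Ab] [/= _ Bb]] := pq (setT `*` A) (setT `*` B).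
  + by exists (setT, A) => //; split => //; exact: filterT.
  + by exists (setT, B) => //; split => //; exact: filterT.
  + by exists b.
Qed.

Lemma open_setX (T U : topologicalType) (A : set T) (B : set U) :
  open A -> open B -> open (A `*` B).
Proof.
rewrite !openE => oA oB [a b] [/= Aa Bb]; exists (A, B) => //=.
by split; [exact: oA | exact: oB].
Qed.

Lemma prod_second_countable : @second_countable pt.
Proof.
have [B1 cB1 [oB1 bB1]] := @manifold_second_countable _ _ M1.
have [B2 cB2 [oB2 bB2]] := @manifold_second_countable _ _ M2.
exists ((fun AB => AB.1 `*` AB.2) @` (B1 `*` B2)).
  exact: (sub_countable (card_image_le _ _) (countableX cB1 cB2)).
split; first by move=> _ [[A B] [/= /oB1 oA /oB2 oB] <-]; exact: open_setX.
move=> [p1 p2] P [[A B] [/= nA nB] ABP].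
have [A' [BA' Ap] AA'] := bB1 _ _ nA; have [B' [BB' Bp] BB''] := bB2 _ _ nB.
exists (A' `*` B'); first by split => //; exists (A', B').
by apply: subset_trans ABP => -[a b] [/= Aa Bb]; split; [exact: AA'|exact: BB''].
Qed.

Lemma prod_imageE (i : ix) : prod_chart i @` prod_dom i =
  [set z | (chart i.1 @` chart_dom i.1) (lsubmx z) /\
           (chart i.2 @` chart_dom i.2) (rsubmx z)].
Proof.
apply/seteqP; split => z /=.
  by move=> [[a b] [/= da db] <-]; rewrite row_mxKl row_mxKr; split;
    [exists a | exists b].
move=> [[a da az] [b db bz]]; exists (a, b) => //.
by rewrite /prod_chart/= az bz hsubmxK.
Qed.

Lemma prod_imageO (i : ix) : open (prod_chart i @` prod_dom i).
Proof.
rewrite prod_imageE; apply: openI.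
- apply: (@open_comp _ _ (@lsubmx R 1 n1 n2)); last exact: chart_imageO.
  by move=> z _; exact: continuous_lsubmx.
- apply: (@open_comp _ _ (@rsubmx R 1 n1 n2)); last exact: chart_imageO.
  by move=> z _; exact: continuous_rsubmx.
Qed.

Lemma continuous_row_mx (T : topologicalType) (f : T -> 'rV[R]_n1)
    (g : T -> 'rV[R]_n2) (x : T) :
  {for x, continuous f} -> {for x, continuous g} ->
  {for x, continuous (fun y => row_mx (f y) (g y))}.
Proof.
move=> cf cg A /nbhs_ballP[e /= e0 eA].
have nf : \forall y \near x, ball (f x) e (f y).
  exact: cf (nbhsx_ballx _ _ e0).
have ng : \forall y \near x, ball (g x) e (g y).
  exact: cg (nbhsx_ballx _ _ e0).
apply: filterS2 nf ng => y [_ Bf] [_ Bg]; apply: eA; split => // i j.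
by rewrite !mxE; case: (fintype.split j) => k; [exact: Bf | exact: Bg].
Qed.

Lemma prod_chart_continuous (i : ix) p : prod_dom i p ->
  {for p, continuous (prod_chart i)}.
Proof.
case: p => a b [/= da db]; apply: continuous_row_mx.
- apply: (@continuous_comp _ _ _ fst (chart i.1)); first exact: cvg_fst.
  exact: chart_continuous.
- apply: (@continuous_comp _ _ _ snd (chart i.2)); first exact: cvg_snd.
  exact: chart_continuous.
Qed.

Lemma prod_inv_continuous (i : ix) z : (prod_chart i @` prod_dom i) z ->
  {for z, continuous (prod_inv i)}.
Proof.
rewrite prod_imageE => -[z1 z2].
have c1 : {for z, continuous (chart_inv i.1 \o lsubmx)}.
  apply: continuous_comp; first exact: continuous_lsubmx.
  exact: chart_inv_continuous.
have c2 : {for z, continuous (chart_inv i.2 \o rsubmx)}.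
  apply: continuous_comp; first exact: continuous_rsubmx.
  exact: chart_inv_continuous.
exact: cvg_pair c1 c2.
Qed.

Lemma is_diff_near_eq (V W : normedModType R) (f g : V -> W) (dg : V -> W) x :
  (\forall y \near x, f y = g y) -> is_diff x g dg -> is_diff x f dg.
Proof.
move=> fg [dgx <-].
have fgx : f x = g x by exact: nbhs_singleton fg.
have E : f \o shift x = cst (f x) + 'd g x +o_ 0 id.
  apply/eqaddoP => e e0.
  have /diff_locally/eqaddoP/(_ e e0) := dgx.
  have : \forall y \near 0, f (y + x) = g (y + x).
    by move: fg; rewrite [in X in X -> _](near_shift 0 x) subr0.
  by apply: filterS2 => y; rewrite !fctE /= fgx => ->.
have dE : 'd f x = 'd g x :> (V -> W).
  by apply: diff_unique => //; exact: diff_continuous.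
apply: DiffDef => //; apply/diff_locallyP; split; last by rewrite dE.
by rewrite dE; exact: diff_continuous.
Qed.

Lemma is_diff_row_mx (V : normedModType R) (f df : V -> 'rV[R]_n1)
    (g dg : V -> 'rV[R]_n2) x :
  is_diff x f df -> is_diff x g dg ->
  is_diff x (fun z => row_mx (f z) (g z)) (fun v => row_mx (df v) (dg v)).
Proof.
move=> fx gx.
have linl : linear (fun a : 'rV[R]_n1 => row_mx a (0 : 'rV[R]_n2)).
  by move=> t a b; rewrite scale_row_mx add_row_mx scaler0 addr0.
have linr : linear (fun a : 'rV[R]_n2 => row_mx (0 : 'rV[R]_n1) a).
  by move=> t a b; rewrite scale_row_mx add_row_mx scaler0 addr0.
pose l : {linear _ -> _} := HB.pack (fun a => row_mx a (0 : 'rV[R]_n2))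
  (GRing.isLinear.Build _ _ _ _ _ linl).
pose r : {linear _ -> _} := HB.pack (fun a => row_mx (0 : 'rV[R]_n1) a)
  (GRing.isLinear.Build _ _ _ _ _ linr).
have lc : continuous l.
  move=> a; apply: (@continuous_row_mx _ id (cst 0) a); last exact: cst_continuous.
  by move=> A.
have rc : continuous r.
  move=> a; apply: (@continuous_row_mx _ (cst 0) id a); first exact: cst_continuous.
  by move=> A.
have ld a : is_diff a l l.
  by apply: DiffDef; [exact: linear_differentiable | exact: diff_lin].
have rd a : is_diff a r r.
  by apply: DiffDef; [exact: linear_differentiable | exact: diff_lin].
have -> : (fun z => row_mx (f z) (g z)) = (l \o f) + (r \o g).
  by apply/funext => z; rewrite fctE /= add_row_mx addr0 add0r.
have -> : (fun z => row_mx (df z) (dg z)) = (l \o df) + (r \o dg).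
  by apply/funext => z; rewrite fctE /= add_row_mx addr0 add0r.
exact: is_diffD.
Qed.

Lemma is_diff_lsubmx (z : 'rV[R]_(n1 + n2)) : is_diff z lsubmx lsubmx.
Proof.
apply: DiffDef; first exact: differentiable_lsubmx.
by apply: diff_lin; exact: continuous_lsubmx.
Qed.

Lemma is_diff_rsubmx (z : 'rV[R]_(n1 + n2)) : is_diff z rsubmx rsubmx.
Proof.
apply: DiffDef; first exact: differentiable_rsubmx.
by apply: diff_lin; exact: continuous_rsubmx.
Qed.

Lemma Ck_row_mx k (U : set 'rV[R]_(n1 + n2)) (U1 : set 'rV[R]_n1)
    (U2 : set 'rV[R]_n2) f f1 f2 :
  open U -> (forall z, U z -> U1 (lsubmx z) /\ U2 (rsubmx z)) ->
  Ck k U1 f1 -> Ck k U2 f2 ->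
  (forall z, U z -> f z = row_mx (f1 (lsubmx z)) (f2 (rsubmx z))) ->
  @Ck R _ 'rV[R]_(n1 + n2) k U f.
Proof.
move=> oU UU; elim: k f f1 f2 => [|k IH] f f1 f2 /= C1 C2 fE.
  move=> z Uz; have [z1 z2] := UU _ Uz.
  rewrite /prop_for /continuous_at fE //.
  have : {for z, continuous (fun z => row_mx (f1 (lsubmx z)) (f2 (rsubmx z)))}.
    apply: continuous_row_mx.
    - by apply: continuous_comp; [exact: continuous_lsubmx | exact: C1].
    - by apply: continuous_comp; [exact: continuous_rsubmx | exact: C2].
  move=> c A nA.
  have nc : \forall y \near z, A (row_mx (f1 (lsubmx y)) (f2 (rsubmx y))).
    exact: c nA.
  have nU : \forall y \near z, U y by exact: open_nbhs_nbhs.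
  by apply: filterS2 nU nc => y Uy /=; rewrite fE.
have D z : U z -> is_diff z f (fun v =>
    row_mx ('d f1 (lsubmx z) (lsubmx v)) ('d f2 (rsubmx z) (rsubmx v))).
  move=> Uz; have [z1 z2] := UU _ Uz.
  apply: (@is_diff_near_eq _ _ _
    (fun z => row_mx (f1 (lsubmx z)) (f2 (rsubmx z)))).
    have nU : \forall y \near z, U y by exact: open_nbhs_nbhs.
    by apply: filterS nU => y Uy; rewrite fE.
  apply: is_diff_row_mx.
  - have := differentiableP (C1.1 _ z1); have := is_diff_lsubmx z.
    exact: is_diff_comp.
  - have := differentiableP (C2.1 _ z2); have := is_diff_rsubmx z.
    exact: is_diff_comp.
split=> [z /D [] //|v]; apply: (IH _ _ _ (C1.2 (lsubmx v)) (C2.2 (rsubmx v))).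
move=> z Uz; have [z1 z2] := UU _ Uz; have [df dE] := D _ Uz.
by rewrite !deriveE ?dE//; [exact: C2.1 | exact: C1.1].
Qed.

Lemma image_chartI (n : nat) (M : manifold R n) (i j : charts M) :
  chart i @` (chart_dom i `&` chart_dom j) =
  chart_image i `&` chart_inv i @^-1` chart_dom j.
Proof.
apply/seteqP; split => x /=.
  by move=> [p [pi pj] <-]; rewrite chartK//; split => //; exists p.
by move=> [[p pi <-]]; rewrite chartK// => pj; exists p.
Qed.

Lemma open_image_chartI (n : nat) (M : manifold R n) (i j : charts M) :
  open (chart i @` (chart_dom i `&` chart_dom j)).
Proof.
rewrite image_chartI openE => x [xi xj].
apply: filterI; first by apply: open_nbhs_nbhs; split => //; exact: chart_imageO.
apply: (chart_inv_continuous xi); apply: open_nbhs_nbhs; split => //.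
exact: chart_domO.
Qed.

Lemma prod_transition_smooth (i j : ix) :
  smooth_on (prod_chart i @` (prod_dom i `&` prod_dom j))
    (prod_chart j \o prod_inv i).
Proof.
have E : prod_chart i @` (prod_dom i `&` prod_dom j) =
    [set z | (chart i.1 @` (chart_dom i.1 `&` chart_dom j.1)) (lsubmx z) /\
             (chart i.2 @` (chart_dom i.2 `&` chart_dom j.2)) (rsubmx z)].
  apply/seteqP; split => z /=.
    move=> [[a b] [[/= ai bi] [/= aj bj]] <-].
    by rewrite row_mxKl row_mxKr; split; [exists a | exists b].
  move=> [[a [ai aj] az] [b [bi bj] bz]]; exists (a, b) => //.
  by rewrite /prod_chart/= az bz hsubmxK.
move=> k; rewrite E; apply: (Ck_row_mx (f1 := chart j.1 \o chart_inv i.1)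
  (f2 := chart j.2 \o chart_inv i.2) _ _ (transition_smooth _ _ _)
  (transition_smooth _ _ _)) => //.
apply: openI.
- apply: (@open_comp _ _ (@lsubmx R 1 n1 n2)); last exact: open_image_chartI.
  by move=> z _; exact: continuous_lsubmx.
- apply: (@open_comp _ _ (@rsubmx R 1 n1 n2)); last exact: open_image_chartI.
  by move=> z _; exact: continuous_rsubmx.
Qed.

Lemma prod_chart_atP p : prod_dom (prod_chart_at p) p.
Proof. by split; exact: chart_atP. Qed.

Lemma prod_domO (i : ix) : open (prod_dom i).
Proof. by apply: open_setX; exact: chart_domO. Qed.

Lemma prod_chartK (i : ix) p : prod_dom i p -> prod_inv i (prod_chart i p) = p.
Proof.
by case: p => a b [/= da db]; rewrite /prod_inv row_mxKl row_mxKr /= !chartK.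
Qed.

Definition product_manifold : manifold R (n1 + n2) :=
  @Manifold R (n1 + n2) (M1 * M2)%type prod_hausdorff prod_second_countable
    ix prod_dom prod_chart prod_inv prod_chart_at prod_chart_atP prod_domO
    prod_imageO prod_chartK prod_chart_continuous prod_inv_continuous
    prod_transition_smooth.

(* The preferred chart at [p] being the product of the preferred charts at
   [p.1] and [p.2], the components of a tangent vector [w] in T_{p.1} M1 and
   T_{p.2} M2 are [lsubmx w] and [rsubmx w]. *)
Definition twisted_product (F1 : M1 -> 'rV[R]_n1 -> R) (F2 : M2 -> 'rV[R]_n2 -> R)
    (f : product_manifold -> R) (p : product_manifold) (w : 'rV[R]_(n1 + n2)) : R :=
  Num.sqrt (F1 p.1 (lsubmx w) ^+ 2 + f p ^+ 2 * F2 p.2 (rsubmx w) ^+ 2).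

Definition twisted_domain (p : product_manifold) : set 'rV[R]_(n1 + n2) :=
  [set w | lsubmx w != 0 /\ rsubmx w != 0].

End product_manifold.

Arguments twisted_domain {R n1 n2} M1 M2 p.

(* Main.v *)
Require Import Defs.
From HB Require Import structures.
From mathcomp Require Import all_boot all_order all_algebra.
From mathcomp Require Import all_classical all_reals all_analysis.
From mathcomp Require Import ring lra.
Import Order.TTheory GRing.Theory Num.Theory.
Import numFieldNormedType.Exports.
Local Open Scope classical_set_scope.
Local Open Scope ring_scope.

(* Write [F^2 = A(x, y) + phi(x, u) B(u, v)] with [A = F1^2], [B = F2^2] and
   [phi = f^2].  At a fixed base point the spray coefficients have the form
   [G^i = p^i(y) + q^i(y) B(v)] on the first factor and
   [G^a = s^a(v) + l(y) v^a], with [l] linear, on the second one.  Hence the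
   mixed mean Berwald curvature is [E_ia = K_i(y) B_a(v)], while
   [F^-1 h_ia = F_ia = - phi A_i B_a / (4 F^3)].  If [E] is isotropic with
   factor [c], then choosing [i] and [a] with [A_i] and [B_a] nonzero, which
   exist by Euler's identity, makes [c / F^3] independent of [v].  As [F] is
   not invariant under [v |-> 2 v], this forces [c = 0]. *)

(** * Directional derivatives along lines and in blocks of coordinates *)

Section derivatives.
Context {R : realType}.

Lemma near_open {T : topologicalType} {U : set T} {P : T -> Prop} {x : T} :
  open U -> U x -> (forall y, U y -> P y) -> \forall y \near x, P y.
Proof. by move=> oU Ux UP; apply: filterS UP _; exact: open_nbhs_nbhs. Qed.

Lemma derive_eq_on {V W : normedModType R} {U : set V} {f g : V -> W} {x : V}
    (v : V) :
  open U -> U x -> {in U, f =1 g} -> 'D_v f x = 'D_v g x.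
Proof.
move=> oU Ux fg; apply: near_eq_derive.
by apply: (near_open oU Ux) => y Uy; apply: fg; rewrite inE.
Qed.

(** A directional derivative depends only on the increments along one line. Functions on different
    spaces can thus be compared, and terms constant along the line dropped, without checking
    derivability. *)
Lemma derive_eq_line {V V' W : normedModType R} {f : V -> W} {g : V' -> W}
    {a v : V} {b w : V'} :
  (forall h : R, f (h *: v + a) - f a = g (h *: w + b) - g b) ->
  'D_v f a = 'D_w g b.
Proof.
move=> fg; rewrite /derive.
suff -> : (fun h : R => h^-1 *: ((f \o shift a) (h *: v) - f a)) =
    (fun h => h^-1 *: ((g \o shift b) (h *: w) - g b)) by [].
by apply/funext => h /=; rewrite fg.
Qed.

Lemma derivable_eq_line {V V' W : normedModType R} {f : V -> W} {g : V' -> W}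
    {a v : V} {b w : V'} :
  (forall h : R, f (h *: v + a) - f a = g (h *: w + b) - g b) ->
  derivable f a v -> derivable g b w.
Proof.
move=> fg; rewrite /derivable.
suff -> : (fun h : R => h^-1 *: ((f \o shift a) (h *: v) - f a)) =
    (fun h => h^-1 *: ((g \o shift b) (h *: w) - g b)) by [].
by apply/funext => h /=; rewrite fg.
Qed.

(* No derivability is needed, as the derivative of a function which is not
   derivable is [0]. *)
Lemma deriveZ_total {V : normedModType R} (k : R) (f : V -> R) (x v : V) :
  'D_v (fun y => k * f y) x = k * 'D_v f x.
Proof.
have [->|k0] := eqVneq k 0.
  by rewrite mul0r; under eq_fun do rewrite mul0r; exact: derive_cst.
have [df|ndf] := pselect (derivable f x v); first exact: (deriveZ k df).
have ndkf : ~ derivable (fun y => k * f y) x v.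
  move=> dkf; apply: ndf.
  suff -> : f = k^-1 \*: (fun y => k * f y) by exact: derivableZ dkf.
  by apply/funext => y; exact/esym/mulKf.
have -> : 'D_v f x = 0 by exact: dvgP ndf.
by rewrite mulr0; exact: dvgP ndkf.
Qed.

Lemma derive_lblock {n1 n2 : nat} (H : 'rV[R]_n1 -> 'rV[R]_n2 -> R) i w :
  'D_(delta_mx 0 (lshift n2 i)) (fun w => H (lsubmx w) (rsubmx w)) w =
  'D_(delta_mx 0 i) (H ^~ (rsubmx w)) (lsubmx w).
Proof.
apply: derive_eq_line => h; rewrite !linearD !linearZ /=; congr (H _ _ - _).
- congr (_ *: _ + _); apply/rowP => j; rewrite !mxE eqxx /=.
  by rewrite (inj_eq (@lshift_inj _ _)).
- rewrite -[RHS]add0r; congr (_ + _); apply/rowP => j; rewrite !mxE eqxx /=.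
  by rewrite eq_rlshift mulr0.
Qed.

Lemma derive_rblock {n1 n2 : nat} (H : 'rV[R]_n1 -> 'rV[R]_n2 -> R) i w :
  'D_(delta_mx 0 (rshift n1 i)) (fun w => H (lsubmx w) (rsubmx w)) w =
  'D_(delta_mx 0 i) (H (lsubmx w)) (rsubmx w).
Proof.
apply: derive_eq_line => h; rewrite !linearD !linearZ /=; congr (H _ _ - _).
- rewrite -[RHS]add0r; congr (_ + _); apply/rowP => j; rewrite !mxE eqxx /=.
  by rewrite eq_lrshift mulr0.
- congr (_ *: _ + _); apply/rowP => j; rewrite !mxE eqxx /=.
  by rewrite (inj_eq (@rshift_inj _ _)).
Qed.

Lemma is_derive_eq_line {V V' W : normedModType R} {f : V -> W} {g : V' -> W}
    {a v : V} {b w : V'} {df : W} :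
  (forall h : R, f (h *: v + a) - f a = g (h *: w + b) - g b) ->
  is_derive a v f df -> is_derive b w g df.
Proof.
move=> fg [dfa <-]; split; first exact: derivable_eq_line fg dfa.
exact/esym/derive_eq_line.
Qed.

(** The one-variable chain rule is applied to the restriction of [f] to the line through [x]
    directed by [v]. *)
Lemma is_derive_sqrt_comp {V : normedModType R} {f : V -> R} {x v : V} {df : R} :
  is_derive x v f df -> 0 < f x ->
  is_derive x v (fun y => Num.sqrt (f y)) (df / (2 * Num.sqrt (f x))).
Proof.
move=> dfx fx0.
(* The form [h * 1 + 0] is a step [h] from [0] in direction [1], which matches increments along [v]
   with those of a function of [h]. *)
have lineE (g : V -> R) (h : R) : g (h *: v + x) - g x =
    g ((h * 1 + 0) *: v + x) - g ((0 : R) *: v + x).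
  by rewrite addr0 scale0r add0r mulr1.
pose l (h : R) := f (h *: v + x).
have dl : is_derive (0 : R) 1 l df.
  by apply: is_derive_eq_line dfx; exact: lineE.
have l0 : l 0 = f x by rewrite /l scale0r add0r.
have ds : is_derive (l 0) 1 Num.sqrt (2 * Num.sqrt (f x))^-1.
  by rewrite l0; exact: is_derive1_sqrt.
have := is_derive1_comp ds dl; rewrite mulrC.
by apply: is_derive_eq_line => h; exact/esym/(lineE (Num.sqrt \o f)).
Qed.

(** * Derivability of determinants and inverse matrices *)

Lemma derivable_bigsum {V : normedModType R} {I : Type} (r : seq I) (P : pred I)
    (h : I -> V -> R) (x v : V) :
  (forall i, derivable (h i) x v) ->
  derivable (fun y => \sum_(i <- r | P i) h i y) x v.
Proof.
move=> dh; elim: r => [|i r IH].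
  by under eq_fun do rewrite big_nil; exact: derivable_cst.
under eq_fun do rewrite big_cons.
by case: (P i); [exact: (derivableD (dh i) IH) | exact: IH].
Qed.

Lemma derivable_bigprod {V : normedModType R} {I : Type} (r : seq I) (P : pred I)
    (h : I -> V -> R) (x v : V) :
  (forall i, derivable (h i) x v) ->
  derivable (fun y => \prod_(i <- r | P i) h i y) x v.
Proof.
move=> dh; elim: r => [|i r IH].
  by under eq_fun do rewrite big_nil; exact: derivable_cst.
under eq_fun do rewrite big_cons.
by case: (P i); [exact: (derivableM (dh i) IH) | exact: IH].
Qed.

Lemma derivable_det {V : normedModType R} {n : nat} (M : V -> 'M[R]_n) (x v : V) :
  (forall i j, derivable (fun y => M y i j) x v) ->
  derivable (fun y => \det (M y)) x v.
Proof.
move=> dM; apply: derivable_bigsum => s.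
apply: (derivableM (f := cst _)); first exact: derivable_cst.
by apply: derivable_bigprod => i; exact: dM.
Qed.

(** Near [x] the inverse is the adjugate divided by the determinant, and both of these are
    polynomial in the entries. *)
Lemma derivable_invmx {V : normedModType R} {n : nat} {U : set V}
    {M : V -> 'M[R]_n} {x v : V} (i j : 'I_n) :
  open U -> U x -> (forall y, U y -> M y \in unitmx) ->
  (forall i j, derivable (fun y => M y i j) x v) ->
  derivable (fun y => invmx (M y) i j) x v.
Proof.
move=> oU Ux uM dM.
apply: (@near_eq_derivable _ _ _ (fun y => (\det (M y))^-1 * (\adj (M y)) i j)).
  by apply: (near_open oU Ux) => y /uM My; rewrite /invmx My !mxE.
apply: derivableM.
  apply: derivableV; last exact: derivable_det.
  by have := uM _ Ux; rewrite unitmxE unitfE.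
under eq_fun do rewrite mxE /cofactor.
apply: (derivableM (f := cst _)); first exact: derivable_cst.
by apply: derivable_det => k l; under eq_fun do rewrite !mxE; exact: dM.
Qed.

(** * Homogeneous functions *)

Lemma derive_deltaE {n : nat} {h : 'rV[R]_n -> R} {y : 'rV[R]_n} (v : 'rV[R]_n) :
  differentiable h y -> 'D_v h y = \sum_i 'D_(delta_mx 0 i) h y * v 0 i.
Proof.
move=> dh; rewrite deriveE// [in LHS](row_sum_delta v) linear_sum /=.
by apply: eq_bigr => i _; rewrite linearZ /= deriveE// mulrC.
Qed.

(** Both sides are the derivative of [t |-> h (t *: y)] at [t = 1]. *)
Lemma euler_homogeneous {n : nat} (k : nat) {h : 'rV[R]_n -> R} {y : 'rV[R]_n} :
  differentiable h y ->
  (forall t : R, 0 < t -> h (t *: y) = t ^+ k * h y) ->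
  \sum_i 'D_(delta_mx 0 i) h y * y 0 i = k%:R * h y.
Proof.
move=> dh hom; rewrite -derive_deltaE//.
have -> : 'D_y h y = 'D_1 (fun t : R => h (t *: y)) (1 : R).
  apply: derive_eq_line => t.
  by rewrite scale1r scalerDl scale1r [t *: 1]mulr1.
have -> : 'D_1 (fun t : R => h (t *: y)) (1 : R) =
    'D_1 (fun t : R => h y * t ^+ k) (1 : R).
  have o0 : open [set t : R | 0 < t] by exact: open_gt.
  apply: (derive_eq_on _ o0); first by rewrite /= ltr01.
  by move=> t; rewrite inE /= mulrC; exact: hom.
rewrite deriveZ_total exp_derive -[X in _ * X]/(k%:R * 1 ^+ k.-1 * 1).
by rewrite expr1n !mulr1 mulrC.
Qed.

(** The map [z |-> h (t *: z)] is differentiated at [y] in two ways; the inner dilation contributes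
    one factor [t], which cancels. *)
Lemma derive_homogeneous {n : nat} (k : nat) {h : 'rV[R]_n -> R} {t : R}
    {y : 'rV[R]_n} (v : 'rV[R]_n) :
  differentiable h (t *: y) -> 0 < t ->
  (forall z, h (t *: z) = t ^+ k.+1 * h z) ->
  'D_v h (t *: y) = t ^+ k * 'D_v h y.
Proof.
move=> dh t0 hom; apply: (mulfI (lt0r_neq0 t0)).
have tE : 'D_v (fun z => h (t *: z)) y = t ^+ k.+1 * 'D_v h y.
  by rewrite -deriveZ_total; congr ('D_v _ y); apply/funext => z; rewrite hom.
rewrite mulrA -exprS -tE.
have -> : t * 'D_v h (t *: y) = 'D_(t *: v) h (t *: y).
  by rewrite !deriveE// linearZ.
by apply: derive_eq_line => s; rewrite scalerDr !scalerA mulrC.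
Qed.

End derivatives.

(** * Closure properties of C^k functions *)

Section smoothness.
Context {R : realType} {V : normedModType R}.

Lemma CkS {W : normedModType R} {k} {U : set V} {f : V -> W} :
  Ck k.+1 U f -> Ck k U f.
Proof.
elim: k f => [|k IH] f [df Df].
  by move=> x /df; exact: differentiable_continuous.
by split => // v; apply: IH.
Qed.

Lemma eq_Ck {W : normedModType R} {k} {U : set V} {f g : V -> W} :
  open U -> {in U, f =1 g} -> Ck k U f -> Ck k U g.
Proof.
move=> oU; elim: k f g => [|k IH] f g fg.
  move=> cf x Ux; have gf : \forall y \near x, f y = g y.
    by apply: (near_open oU Ux) => y Uy; apply: fg; rewrite inE.
  rewrite /prop_for /continuous_at -fg ?inE//.
  apply: cvg_trans (cf x Ux).
  exact: near_eq_cvg.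
move=> [df Df]; split => [x Ux|v].
  have gf : \forall y \near x, g y = f y.
    by apply: (near_open oU Ux) => y Uy; rewrite fg ?inE.
  by have [] := is_diff_near_eq gf (differentiableP (df x Ux)).
apply: IH (Df v) => x; rewrite inE => Ux; exact: derive_eq_on oU Ux fg.
Qed.

Lemma CkD {k} {U : set V} {f g : V -> R} :
  open U -> Ck k U f -> Ck k U g -> Ck k U (fun x => f x + g x).
Proof.
move=> oU; elim: k f g => [|k IH] f g.
  by move=> cf cg x Ux; apply: (@continuousD _ R _ f g); [exact: cf|exact: cg].
move=> [df Df] [dg Dg]; split => [x Ux|v].
  by apply: (@differentiableD _ _ _ f g); [exact: df|exact: dg].
apply: (eq_Ck oU _ (IH _ _ (Df v) (Dg v))) => x; rewrite inE => Ux.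
apply/esym; apply: (@deriveD _ _ _ f g).
  by apply: diff_derivable; exact: df.
by apply: diff_derivable; exact: dg.
Qed.

(** Leibniz rule; [CkS] lowers the order of the factor that is not differentiated, so that the
    induction hypothesis applies. *)
Lemma CkM {k} {U : set V} {f g : V -> R} :
  open U -> Ck k U f -> Ck k U g -> Ck k U (fun x => f x * g x).
Proof.
move=> oU; elim: k f g => [|k IH] f g.
  by move=> cf cg x Ux; apply: (@continuousM _ _ f g); [exact: cf|exact: cg].
move=> Cf Cg; have [df Df] := Cf; have [dg Dg] := Cg; split => [x Ux|v].
  by apply: (@differentiableM _ _ f g); [exact: df|exact: dg].
apply: (eq_Ck oU _ (CkD oU (IH _ _ (CkS Cf) (Dg v)) (IH _ _ (CkS Cg) (Df v)))).
move=> x; rewrite inE => Ux.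
apply/esym; apply: (@deriveM _ _ f g).
  by apply: diff_derivable; exact: df.
by apply: diff_derivable; exact: dg.
Qed.

Lemma smooth_on_derive {W : normedModType R} {U : set V} {f : V -> W} (v : V) :
  smooth_on U f -> smooth_on U ('D_v f).
Proof. by move=> sf k; exact: (sf k.+1).2. Qed.

End smoothness.

(** * Finsler metrics in coordinates *)

Section local_finsler_metric.
Context {R : realType} {n : nat}.
Implicit Types (U : set 'rV[R]_n) (L G : 'rV[R]_n -> 'rV[R]_n -> R).

(** Properties of a Finsler metric read in a chart of image [U]; the curvature computation then
    takes place in R^n. *)
Record finsler_on U L : Prop := FinslerOn {
  finsler_on_open : open U ;
  finsler_on_smooth : smooth_on (U `*` [set y : 'rV[R]_n | y != 0])
    (fun z : 'rV[R]_n * 'rV[R]_n => L z.1 z.2) ;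
  finsler_on_homogeneous : forall (x : 'rV[R]_n) (t : R) (y : 'rV[R]_n), U x -> 0 < t ->
    L x (t *: y) = t * L x y ;
  finsler_on_posdef : forall x y v : 'rV[R]_n, U x -> y != 0 -> v != 0 ->
    0 < (v *m fundamental_tensor L x y *m v^T) 0 0
}.

Lemma open_slit : open [set y : 'rV[R]_n | y != 0].
Proof.
have -> : [set y : 'rV[R]_n | y != 0] = ~` [set 0].
  by apply/seteqP; split => y /= /eqP.
rewrite openC; apply: accessible_closed_set1.
exact/hausdorff_accessible/norm_hausdorff.
Qed.

(** The partial derivative is a directional derivative of the joint function on pairs, so it
    inherits smoothness. *)
Lemma smooth_dx {S : set ('rV[R]_n * 'rV[R]_n)} {G} (k : 'I_n) :
  smooth_on S (fun z => G z.1 z.2) -> smooth_on S (fun z => dx k G z.1 z.2).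
Proof.
move=> sG; suff -> : (fun z => dx k G z.1 z.2) =
    'D_(delta_mx 0 k, 0) (fun z => G z.1 z.2) by exact: smooth_on_derive.
apply/funext => -[x y] /=; apply: derive_eq_line => h /=.
by rewrite scaler0 add0r.
Qed.

Lemma smooth_dy {S : set ('rV[R]_n * 'rV[R]_n)} {G} (k : 'I_n) :
  smooth_on S (fun z => G z.1 z.2) -> smooth_on S (fun z => dy k G z.1 z.2).
Proof.
move=> sG; suff -> : (fun z => dy k G z.1 z.2) =
    'D_(0, delta_mx 0 k) (fun z => G z.1 z.2) by exact: smooth_on_derive.
apply/funext => -[x y] /=; apply: derive_eq_line => h /=.
by rewrite scaler0 add0r.
Qed.

Lemma differentiable_fibre {S : set ('rV[R]_n * 'rV[R]_n)} {G x y} :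
  smooth_on S (fun z => G z.1 z.2) -> S (x, y) -> differentiable (G x) y.
Proof.
move=> sG Sxy; have dG := (sG 1%N).1 _ Sxy.
by apply: (@differentiable_comp _ _ _ _ (fun y => (x, y)) (fun z => G z.1 z.2)) => //.
Qed.

Lemma differentiable_base {S : set ('rV[R]_n * 'rV[R]_n)} {G x y} :
  smooth_on S (fun z => G z.1 z.2) -> S (x, y) -> differentiable (G ^~ y) x.
Proof.
move=> sG Sxy; have dG := (sG 1%N).1 _ Sxy.
by apply: (@differentiable_comp _ _ _ _ (fun x => (x, y)) (fun z => G z.1 z.2)) => //.
Qed.

Section metric.
Context {U : set 'rV[R]_n} {L : 'rV[R]_n -> 'rV[R]_n -> R}.
Hypothesis fL : finsler_on U L.
Context {x y : 'rV[R]_n}.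
Hypotheses (Ux : U x) (y0 : y != 0).

Let S := U `*` [set y : 'rV[R]_n | y != 0].
Let Sxy : S (x, y). Proof. by split. Qed.

Lemma smooth_sq : smooth_on S (fun z => sq L z.1 z.2).
Proof.
have oS : open S by apply: open_setX; [exact: finsler_on_open fL | exact: open_slit].
by move=> k; apply: CkM => //; exact: finsler_on_smooth fL _.
Qed.

Lemma sq_homogeneous (t : R) z : 0 < t -> sq L x (t *: z) = t ^+ 2 * sq L x z.
Proof. by move=> t0; rewrite /sq (finsler_on_homogeneous _ _ fL)// exprMn. Qed.

Lemma dy_sq_homogeneous (t : R) i : 0 < t ->
  dy i (sq L) x (t *: y) = t * dy i (sq L) x y.
Proof.
move=> t0; rewrite -[t in RHS]expr1; apply: derive_homogeneous => //.
- apply: (differentiable_fibre smooth_sq); split => //=.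
  by rewrite scaler_eq0 negb_or y0 gt_eqF.
- by move=> z; exact: sq_homogeneous.
Qed.

Lemma sum_dy_sq : \sum_i dy i (sq L) x y * y 0 i = 2 * sq L x y.
Proof.
apply: (euler_homogeneous 2); first exact: differentiable_fibre smooth_sq Sxy.
by move=> t; exact: sq_homogeneous.
Qed.

(** Euler's identity for [dy b (sq L)], which is homogeneous of degree 1 in the fibre. *)
Lemma fundamental_tensor_mul :
  fundamental_tensor L x y *m y^T = 2^-1 *: \col_b dy b (sq L) x y.
Proof.
apply/colP => b; rewrite !mxE.
under eq_bigr do rewrite !mxE -mulrA.
rewrite -mulr_sumr; congr (_ * _).
rewrite [LHS](@euler_homogeneous _ _ 1 (dy b (sq L) x)) ?mul1r//.
  exact: differentiable_fibre (smooth_dy b smooth_sq) Sxy.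
by move=> t t0; exact: dy_sq_homogeneous.
Qed.

(** By Euler's identity in degrees 1 and 2, contracting the fundamental tensor twice with [y] gives
    [sq L x y]. *)
Lemma sq_gt0 : 0 < sq L x y.
Proof.
have := finsler_on_posdef _ _ fL _ _ _ Ux y0 y0.
rewrite -mulmxA fundamental_tensor_mul mxE.
under eq_bigr do rewrite !mxE mulrCA [y 0 _ * _]mulrC.
by rewrite -mulr_sumr sum_dy_sq mulKf// pnatr_eq0.
Qed.

(** Otherwise Euler's identity would force [sq L x y = 0]. *)
Lemma ex_dy_sq_neq0 : exists i, dy i (sq L) x y != 0.
Proof.
apply/existsP; apply: contraTT isT; rewrite negb_exists => /forallP d0.
have := sum_dy_sq; rewrite big1 => [/esym/eqP|i _].
  by rewrite mulf_eq0 pnatr_eq0 /= gt_eqF// sq_gt0.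
by have := d0 i; rewrite negbK => /eqP ->; rewrite mul0r.
Qed.

Lemma fundamental_tensor_unit : fundamental_tensor L x y \in unitmx.
Proof.
rewrite -row_free_unit; apply: inj_row_free => v vg; apply/eqP.
apply: contraTT isT => v0; have := finsler_on_posdef _ _ fL _ _ _ Ux y0 v0.
by rewrite vg mul0mx mxE ltxx.
Qed.

(** This is [fundamental_tensor_mul] solved for [y]; it produces the factor [v^a] in the twisted
    spray. *)
Lemma sum_inv_fundamental_tensor a :
  \sum_b invmx (fundamental_tensor L x y) a b * dy b (sq L) x y = 2 * y 0 a.
Proof.
have := congr1 (mulmx (invmx (fundamental_tensor L x y))) fundamental_tensor_mul.
rewrite mulKmx ?fundamental_tensor_unit// -scalemxAr => /(congr1 (fun M => 2 *: M)).
rewrite scalerA divff ?pnatr_eq0// scale1r => /colP/(_ a); rewrite !mxE => ->.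
by apply: eq_bigr => b _; rewrite mxE.
Qed.

End metric.

Lemma derivable_inv_fundamental_tensor {U L x y v} i j :
  finsler_on U L -> U x -> y != 0 ->
  derivable (fun y => invmx (fundamental_tensor L x y) i j) y v.
Proof.
move=> fL Ux y0; apply: (derivable_invmx i j open_slit y0).
  by move=> z z0; exact: (fundamental_tensor_unit fL).
move=> k l; under eq_fun do rewrite mxE.
apply: (derivableM (f := cst _)); first exact: derivable_cst.
apply: diff_derivable.
apply: (differentiable_fibre (smooth_dy l (smooth_dy k (smooth_sq fL)))).
by split.
Qed.

(** In the mixed curvature, the spray of the first factor is differentiated once in its own fibre
    before a derivative in the other fibre removes it. *)
Lemma derivable_spray {U L x y v} i :
  finsler_on U L -> U x -> y != 0 -> derivable (spray L i x) y v.
Proof.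
move=> fL Ux y0; have sL := smooth_sq fL.
have Sxy : (U `*` [set y | y != 0]) (x, y) by split.
apply: (derivableM (f := cst _)); first exact: derivable_cst.
apply: derivable_bigsum => l; apply: derivableM.
  exact: (derivable_inv_fundamental_tensor _ _ fL Ux y0).
apply: derivableB; last first.
  exact/diff_derivable/(differentiable_fibre (smooth_dx l sL) Sxy).
apply: derivable_bigsum => k; apply: derivableM.
  exact/diff_derivable/(differentiable_fibre (smooth_dx k (smooth_dy l sL)) Sxy).
exact/diff_derivable/differentiable_coord.
Qed.

End local_finsler_metric.

(** * The twisted product in product coordinates *)

Section twisted_product.
Context {R : realType} {n1 n2 : nat}.
Variables (U1 : set 'rV[R]_n1) (L1 : 'rV[R]_n1 -> 'rV[R]_n1 -> R).
Variables (U2 : set 'rV[R]_n2) (L2 : 'rV[R]_n2 -> 'rV[R]_n2 -> R).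
Hypotheses (fL1 : finsler_on U1 L1) (fL2 : finsler_on U2 L2).

Let U := [set x : 'rV[R]_(n1 + n2) | U1 (lsubmx x) /\ U2 (rsubmx x)].
Let slit := [set w : 'rV[R]_(n1 + n2) | lsubmx w != 0 /\ rsubmx w != 0].

(** [phi] stands for [f^2] in coordinates. It and [F] are constrained over [U] only, as charts are
    meaningless elsewhere. *)
Variable phi : 'rV[R]_(n1 + n2) -> R.
Hypothesis phi_gt0 : forall x, U x -> 0 < phi x.
Hypothesis phi_diff : forall x, U x -> differentiable phi x.

Variable F : 'rV[R]_(n1 + n2) -> 'rV[R]_(n1 + n2) -> R.
Hypothesis FE : forall x w, U x -> F x w =
  Num.sqrt (sq L1 (lsubmx x) (lsubmx w) + phi x * sq L2 (rsubmx x) (rsubmx w)).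

Local Notation el l := (@delta_mx R 1 (n1 + n2) 0 (lshift n2 l)).
Local Notation er b := (@delta_mx R 1 (n1 + n2) 0 (rshift n1 b)).

Let open_blocks (A : set 'rV[R]_n1) (B : set 'rV[R]_n2) : open A -> open B ->
  open [set w : 'rV[R]_(n1 + n2) | A (lsubmx w) /\ B (rsubmx w)].
Proof.
move=> oA oB; apply: openI.
- by apply: (@open_comp _ _ (@lsubmx R 1 n1 n2)) => // z _; exact: continuous_lsubmx.
- by apply: (@open_comp _ _ (@rsubmx R 1 n1 n2)) => // z _; exact: continuous_rsubmx.
Qed.

Let oU : open U.
Proof.
by apply: open_blocks; [exact: finsler_on_open fL1 | exact: finsler_on_open fL2].
Qed.

Let oslit : open slit. Proof. exact: (open_blocks _ _ open_slit open_slit). Qed.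

Let rsubmx_line (h : R) l z : rsubmx (h *: el l + z) = rsubmx z.
Proof. by apply/rowP => j; rewrite !mxE eq_rlshift andbF mulr0 add0r. Qed.

Let lsubmx_line (h : R) b z : lsubmx (h *: er b + z) = lsubmx z.
Proof. by apply/rowP => j; rewrite !mxE eq_lrshift andbF mulr0 add0r. Qed.

(** * Fibre derivatives and fundamental tensor at one base point *)

Section base_point.
Variable x : 'rV[R]_(n1 + n2).
Hypothesis Ux : U x.
Local Notation x1 := (lsubmx x).
Local Notation x2 := (rsubmx x).

Lemma sq_twisted w :
  sq F x w = sq L1 x1 (lsubmx w) + phi x * sq L2 x2 (rsubmx w).
Proof.
rewrite /sq FE// sqr_sqrtr// addr_ge0 ?sqr_ge0//.
by rewrite mulr_ge0 ?sqr_ge0// ltW// phi_gt0.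
Qed.

Lemma dyl_sq_twisted l :
  dy (lshift n2 l) (sq F) x = fun w => dy l (sq L1) x1 (lsubmx w).
Proof.
rewrite /dy (funext sq_twisted); apply/funext => w.
rewrite (derive_lblock (fun y v => sq L1 x1 y + phi x * sq L2 x2 v)).
by apply: derive_eq_line => h; rewrite /= opprD addrACA subrr addr0.
Qed.

Lemma dyr_sq_twisted b :
  dy (rshift n1 b) (sq F) x = fun w => phi x * dy b (sq L2) x2 (rsubmx w).
Proof.
rewrite /dy (funext sq_twisted); apply/funext => w.
rewrite (derive_rblock (fun y v => sq L1 x1 y + phi x * sq L2 x2 v)).
rewrite -deriveZ_total; apply: derive_eq_line => h.
by rewrite /= opprD addrACA subrr add0r.
Qed.

(** At a fixed base point [F^2] is a function of [y] plus a function of [v], so its mixed second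
    derivatives vanish. *)
Lemma fundamental_tensor_twisted w :
  fundamental_tensor F x w =
  block_mx (fundamental_tensor L1 x1 (lsubmx w)) 0 0
           (phi x *: fundamental_tensor L2 x2 (rsubmx w)).
Proof.
apply/matrixP => i j; rewrite mxE {1}/dy.
case: (split_ordP i) => i' -> ; case: (split_ordP j) => j' ->.
- rewrite block_mxEul mxE; congr (_ * _); rewrite dyl_sq_twisted.
  exact: (derive_lblock (fun y _ => dy i' (sq L1) x1 y)).
- rewrite block_mxEur mxE dyl_sq_twisted.
  rewrite (derive_rblock (fun y _ => dy i' (sq L1) x1 y)).
  by rewrite [X in _ * X]derive_cst mulr0.
- rewrite block_mxEdl mxE dyr_sq_twisted.
  rewrite (derive_lblock (fun _ v => phi x * dy i' (sq L2) x2 v)).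
  by rewrite [X in _ * X]derive_cst mulr0.
- rewrite block_mxEdr !mxE mulrCA; congr (_ * _); rewrite dyr_sq_twisted.
  rewrite (derive_rblock (fun _ v => phi x * dy i' (sq L2) x2 v)).
  exact: deriveZ_total.
Qed.

Lemma inv_fundamental_tensor_twisted w : slit w ->
  invmx (fundamental_tensor F x w) =
  block_mx (invmx (fundamental_tensor L1 x1 (lsubmx w))) 0 0
           ((phi x)^-1 *: invmx (fundamental_tensor L2 x2 (rsubmx w))).
Proof.
move=> [w1 w2]; have phi0 : phi x != 0 by rewrite gt_eqF// phi_gt0.
have g1u := fundamental_tensor_unit fL1 Ux.1 w1.
have g2u := fundamental_tensor_unit fL2 Ux.2 w2.
have g2u' : phi x *: fundamental_tensor L2 x2 (rsubmx w) \in unitmx.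
  by rewrite unitmxZ// unitfE.
rewrite fundamental_tensor_twisted invmx_block_diag ?invmxZ//.
by rewrite unitmxE det_ublock unitrM -!unitmxE g1u.
Qed.

End base_point.

(** * Base derivatives, spray and curvature *)

Variable x : 'rV[R]_(n1 + n2).
Hypothesis Ux : U x.
Local Notation x1 := (lsubmx x).
Local Notation x2 := (rsubmx x).

(** The fibre identities above hold over [U] only; since [U] is open, they may still be
    differentiated in the base at [x]. *)
Let dx_on G H k w : (forall x', U x' -> G x' w = H x' w) -> dx k G x w = dx k H x w.
Proof.
by move=> GH; apply: (derive_eq_on _ oU Ux) => x'; rewrite inE; exact: GH.
Qed.

Lemma dxl_dyl_sq_twisted k l w :
  dx (lshift n2 k) (dy (lshift n2 l) (sq F)) x w =
  dx k (dy l (sq L1)) x1 (lsubmx w).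
Proof.
rewrite (dx_on (dy (lshift n2 l) (sq F))
  (fun x' w => dy l (sq L1) (lsubmx x') (lsubmx w))).
  exact: (derive_lblock (fun x1 _ => dy l (sq L1) x1 (lsubmx w))).
by move=> x' Ux'; rewrite dyl_sq_twisted.
Qed.

Lemma dxr_dyl_sq_twisted k l w :
  dx (rshift n1 k) (dy (lshift n2 l) (sq F)) x w = 0.
Proof.
rewrite (dx_on (dy (lshift n2 l) (sq F))
  (fun x' w => dy l (sq L1) (lsubmx x') (lsubmx w))).
  rewrite /dx (derive_rblock (fun x1 _ => dy l (sq L1) x1 (lsubmx w))).
  exact: derive_cst.
by move=> x' Ux'; rewrite dyl_sq_twisted.
Qed.

Lemma dxl_dyr_sq_twisted k b w :
  dx (lshift n2 k) (dy (rshift n1 b) (sq F)) x w =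
  'D_(el k) phi x * dy b (sq L2) x2 (rsubmx w).
Proof.
rewrite (dx_on (dy (rshift n1 b) (sq F))
  (fun x' w => phi x' * dy b (sq L2) (rsubmx x') (rsubmx w))); last first.
  by move=> x' Ux'; rewrite dyr_sq_twisted.
rewrite mulrC -deriveZ_total; apply: derive_eq_line => h.
by rewrite /= rsubmx_line ![phi _ * _]mulrC.
Qed.

(** Along the first factor [rsubmx x] is fixed, so the second summand varies through [phi] alone. *)
Lemma dxl_sq_twisted l w : slit w ->
  dx (lshift n2 l) (sq F) x w =
  dx l (sq L1) x1 (lsubmx w) + 'D_(el l) phi x * sq L2 x2 (rsubmx w).
Proof.
move=> [w1 w2]; rewrite (dx_on (sq F) (fun x' w =>
  sq L1 (lsubmx x') (lsubmx w) + phi x' * sq L2 (rsubmx x') (rsubmx w))); last first.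
  by move=> x' Ux'; rewrite sq_twisted.
have -> : dx (lshift n2 l) (fun x' w =>
    sq L1 (lsubmx x') (lsubmx w) + phi x' * sq L2 (rsubmx x') (rsubmx w)) x w =
    'D_(el l) (fun x' => sq L1 (lsubmx x') (lsubmx w) +
                         sq L2 x2 (rsubmx w) * phi x') x.
  apply: derive_eq_line => h.
  by rewrite /= rsubmx_line ![phi _ * _]mulrC.
rewrite [LHS](@deriveD _ _ _ (fun x' => sq L1 (lsubmx x') (lsubmx w))
  (fun x' => sq L2 x2 (rsubmx w) * phi x')).
- rewrite deriveZ_total [X in _ = _ + X]mulrC; congr (_ + _).
  exact: (derive_lblock (fun x1 _ => sq L1 x1 (lsubmx w))).
- apply: diff_derivable.
  apply: (@differentiable_comp _ _ _ _ lsubmx (sq L1 ^~ (lsubmx w))).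
    exact: differentiable_lsubmx.
  by apply: (differentiable_base (smooth_sq fL1)); split => //; exact: Ux.1.
- by apply: derivableZ; apply: diff_derivable; exact: phi_diff.
Qed.

(** The derivative is left unexpanded: what matters is that it does not involve [lsubmx w]. *)
Lemma dxr_sq_twisted b w :
  dx (rshift n1 b) (sq F) x w =
  'D_(er b) (fun x' => phi x' * sq L2 (rsubmx x') (rsubmx w)) x.
Proof.
rewrite (dx_on (sq F) (fun x' w =>
  sq L1 (lsubmx x') (lsubmx w) + phi x' * sq L2 (rsubmx x') (rsubmx w))); last first.
  by move=> x' Ux'; rewrite sq_twisted.
apply: derive_eq_line => h; rewrite /= lsubmx_line.
by rewrite /= opprD addrACA subrr add0r.
Qed.

(** The coefficient of [B(v)] in [G^i]: up to the factor -1/4, the gradient of [phi] along the first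
    factor for the fundamental tensor of [L1]. *)
Let q i y := - 4^-1 *
  \sum_l invmx (fundamental_tensor L1 x1 y) i l * 'D_(el l) phi x.

(** In the first block, [dy l (sq F)] depends on neither [u] nor [v], so the only term added to the
    spray of [L1] comes from the derivative of [phi] in [dx l (sq F)]. *)
Lemma sprayl_twisted i w : slit w ->
  spray F (lshift n2 i) x w =
  spray L1 i x1 (lsubmx w) + q i (lsubmx w) * sq L2 x2 (rsubmx w).
Proof.
move=> sw; rewrite /spray inv_fundamental_tensor_twisted// big_split_ord /=.
rewrite [X in _ + X]big1 ?addr0 => [|b _]; last first.
  by rewrite block_mxEur mxE mul0r.
rewrite /q !mulNr -mulrA -mulrN -mulrDr; congr (_ * _).
rewrite mulr_suml -sumrN -big_split; apply: eq_bigr => l _ /=.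
rewrite block_mxEul -mulrA -mulrN -mulrDr; congr (_ * _).
rewrite dxl_sq_twisted// big_split_ord /= [X in _ + X - _]big1 ?addr0 => [|c _]; last first.
  by rewrite dxr_dyl_sq_twisted mul0r.
rewrite opprD addrA; congr (_ - _ - _).
by apply: eq_bigr => k _; rewrite dxl_dyl_sq_twisted mxE.
Qed.

(** The derivatives of [F^2] in [x^k] and [v^b] contribute a linear form in [y] times [B_b], and
    raising the index [b] turns [B_b] into [2 v^a]. Everything else is free of [y]. *)
Lemma sprayr_twisted a : exists s, forall w, slit w ->
  spray F (rshift n1 a) x w = s (rsubmx w) +
  (\sum_k 'D_(el k) phi x * lsubmx w 0 k) * ((2 * phi x)^-1 * rsubmx w 0 a).
Proof.
(* [s1] gathers the terms differentiated along the second factor, which involve [v] but not [y]. *)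
pose s1 b v := \sum_c
  'D_(er c) (fun x' => phi x' * dy b (sq L2) (rsubmx x') v) x * v 0 c -
  'D_(er b) (fun x' => phi x' * sq L2 (rsubmx x') v) x.
exists (fun v => 4^-1 * \sum_b
  ((phi x)^-1 * invmx (fundamental_tensor L2 x2 v) a b) * s1 b v) => w sw.
rewrite /spray inv_fundamental_tensor_twisted// big_split_ord /=.
rewrite [X in X + _]big1 ?add0r => [|l _]; last first.
  by rewrite block_mxEdl mxE mul0r.
set p := \sum_k 'D__ phi x * _.
transitivity (4^-1 * \sum_b ((phi x)^-1 *
    invmx (fundamental_tensor L2 x2 (rsubmx w)) a b) *
    (s1 b (rsubmx w) + p * dy b (sq L2) x2 (rsubmx w))).
  congr (_ * _); apply: eq_bigr => b _; rewrite block_mxEdr mxE; congr (_ * _).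
  rewrite dxr_sq_twisted big_split_ord /= -addrA addrC; congr (_ - _ + _).
    apply: eq_bigr => c _; rewrite [rsubmx w _ _]mxE; congr (_ * _).
    apply: (derive_eq_on _ oU Ux) => x'; rewrite inE => Ux'.
    by rewrite dyr_sq_twisted.
  rewrite mulr_suml; apply: eq_bigr => k _.
  by rewrite dxl_dyr_sq_twisted mxE mulrAC.
rewrite (eq_bigr _ (fun b _ => mulrDr _ _ _)) big_split mulrDr /=; congr (_ + _).
under eq_bigr do rewrite mulrACA.
rewrite -mulr_sumr (sum_inv_fundamental_tensor fL2 Ux.2 sw.2).
by field; rewrite gt_eqF// phi_gt0.
Qed.

(** Derivatives are taken in [y^i], in [v^a], then in the traced index. For a traced index in the
    second block, [l(y) v^b] is bilinear and its third derivative vanishes; in the first block only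
    [q^m(y) B(v)] survives. *)
Lemma mean_berwald_twisted i a : exists K, forall w, slit w ->
  mean_berwald F (lshift n2 i) (rshift n1 a) x w =
  K (lsubmx w) * dy a (sq L2) x2 (rsubmx w).
Proof.
pose K y := 2^-1 * \sum_m 'D_(delta_mx 0 m) ('D_(delta_mx 0 i) (q m)) y.
exists K => w sw; rewrite /mean_berwald /K -mulrA; congr (_ * _).
rewrite mulr_suml big_split_ord /= [X in _ + X]big1 ?addr0 => [|b _]; last first.
  have [s sE] := sprayr_twisted b.
  pose p (y : 'rV[R]_n1) := \sum_k 'D_(el k) phi x * y 0 k.
  (* [p] is linear, so its derivative is constant; it is recorded as the value at [0] without being
     computed. *)
  have dp y : 'D_(delta_mx 0 i) p y = 'D_(delta_mx 0 i) p 0.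
    apply: derive_eq_line => h.
    rewrite /p -!sumrB; apply: eq_bigr => k _.
    by rewrite !mxE mulrDr addrK addr0 mulr0 subr0.
  pose v1 (v : 'rV[R]_n2) := v 0 b.
  have dv1 v : 'D_(delta_mx 0 a) v1 v = 'D_(delta_mx 0 a) v1 0.
    by apply: derive_eq_line => h; rewrite /v1 !mxE addrK addr0 subr0.
  have d1 w' : slit w' -> dy (lshift n2 i) (spray F (rshift n1 b)) x w' =
      (2 * phi x)^-1 * 'D_(delta_mx 0 i) p 0 * v1 (rsubmx w').
    move=> sw'; rewrite /dy (derive_eq_on _ oslit sw' (g := fun w =>
      s (rsubmx w) + p (lsubmx w) * ((2 * phi x)^-1 * rsubmx w 0 b))); last first.
      by move=> z; rewrite inE; exact: sE.
    rewrite (derive_lblock (fun y v => s v + p y * ((2 * phi x)^-1 * v 0 b))).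
    rewrite mulrAC -(dp (lsubmx w')) -deriveZ_total; apply: derive_eq_line => h /=.
    by rewrite opprD addrACA subrr add0r ![p _ * _]mulrC.
  have d2 w' : slit w' ->
      dy (rshift n1 a) (dy (lshift n2 i) (spray F (rshift n1 b))) x w' =
      (2 * phi x)^-1 * 'D_(delta_mx 0 i) p 0 * 'D_(delta_mx 0 a) v1 0.
    move=> sw'; rewrite {1}/dy (derive_eq_on _ oslit sw' (g := fun w =>
      (2 * phi x)^-1 * 'D_(delta_mx 0 i) p 0 * v1 (rsubmx w))); last first.
      by move=> z; rewrite inE; exact: d1.
    rewrite (derive_rblock (fun _ v =>
      (2 * phi x)^-1 * 'D_(delta_mx 0 i) p 0 * v1 v)).
    by rewrite deriveZ_total dv1.
  rewrite /berwald {1}/dy (derive_eq_on _ oslit sw (g := cst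
    ((2 * phi x)^-1 * 'D_(delta_mx 0 i) p 0 * 'D_(delta_mx 0 a) v1 0))).
    exact: derive_cst.
  by move=> z; rewrite inE; exact: d2.
apply: eq_bigr => m _.
have d1 w' : slit w' -> dy (lshift n2 i) (spray F (lshift n2 m)) x w' =
    'D_(delta_mx 0 i) (spray L1 m x1) (lsubmx w') +
    'D_(delta_mx 0 i) (q m) (lsubmx w') * sq L2 x2 (rsubmx w').
  move=> sw'; rewrite /dy (derive_eq_on _ oslit sw' (g := fun w =>
    spray L1 m x1 (lsubmx w) + q m (lsubmx w) * sq L2 x2 (rsubmx w))); last first.
    by move=> z; rewrite inE; exact: sprayl_twisted.
  rewrite (derive_lblock (fun y v => spray L1 m x1 y + q m y * sq L2 x2 v)).
  under eq_fun do rewrite [q m _ * _]mulrC.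
  (* Derivability enters here, through the sum rule; the two later derivatives use only increments
     and scalar factors. *)
  have dq : derivable (q m) (lsubmx w') (delta_mx 0 i).
    apply: (derivableM (f := cst _)); first exact: derivable_cst.
    apply: derivable_bigsum => l; apply: derivableM; last exact: derivable_cst.
    exact: (derivable_inv_fundamental_tensor _ _ fL1 Ux.1 sw'.1).
  rewrite [LHS](@deriveD _ _ _ (spray L1 m x1)
    (fun y => sq L2 x2 (rsubmx w') * q m y)).
  - by rewrite deriveZ_total [X in _ + X = _]mulrC.
  - exact: (derivable_spray _ fL1 Ux.1 sw'.1).
  - exact: (derivableZ dq).
have d2 w' : slit w' ->
    dy (rshift n1 a) (dy (lshift n2 i) (spray F (lshift n2 m))) x w' =
    dy a (sq L2) x2 (rsubmx w') * 'D_(delta_mx 0 i) (q m) (lsubmx w').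
  move=> sw'; rewrite {1}/dy (derive_eq_on _ oslit sw' (g := fun w =>
    'D_(delta_mx 0 i) (spray L1 m x1) (lsubmx w) +
    'D_(delta_mx 0 i) (q m) (lsubmx w) * sq L2 x2 (rsubmx w))); last first.
    by move=> z; rewrite inE; exact: d1.
  rewrite (derive_rblock (fun y v => 'D_(delta_mx 0 i) (spray L1 m x1) y +
    'D_(delta_mx 0 i) (q m) y * sq L2 x2 v)).
  rewrite mulrC -deriveZ_total; apply: derive_eq_line => h /=.
  by rewrite opprD addrACA subrr add0r.
rewrite /berwald {1}/dy (derive_eq_on _ oslit sw (g := fun w =>
  dy a (sq L2) x2 (rsubmx w) * 'D_(delta_mx 0 i) (q m) (lsubmx w))); last first.
  by move=> z; rewrite inE; exact: d2.
rewrite (derive_lblock (fun y v =>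
  dy a (sq L2) x2 v * 'D_(delta_mx 0 i) (q m) y)).
by rewrite deriveZ_total mulrC.
Qed.

(** Here [F_i = A_i / (2 F)] with [A_i] free of [v]; it remains to differentiate [1 / (2 F)] using
    [F_a = phi B_a / (2 F)]. *)
Lemma angular_metric_twisted i a w : slit w ->
  (F x w)^-1 * angular_metric F (lshift n2 i) (rshift n1 a) x w =
  - (phi x * dy i (sq L1) x1 (lsubmx w) * dy a (sq L2) x2 (rsubmx w)) /
  (4 * F x w ^+ 3).
Proof.
pose N y v := Num.sqrt (sq L1 x1 y + phi x * sq L2 x2 v).
have FN : F x = fun w => N (lsubmx w) (rsubmx w).
  by apply/funext => z; rewrite FE.
have N2_gt0 y v : y != 0 -> v != 0 -> 0 < sq L1 x1 y + phi x * sq L2 x2 v.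
  move=> y0 v0; rewrite addr_gt0 ?(sq_gt0 fL1 Ux.1)// mulr_gt0 ?phi_gt0//.
  exact: (sq_gt0 fL2 Ux.2).
have N_gt0 y v : y != 0 -> v != 0 -> 0 < N y v.
  by move=> y0 v0; rewrite sqrtr_gt0 N2_gt0.
have d1 w' : slit w' -> dy (lshift n2 i) F x w' =
    dy i (sq L1) x1 (lsubmx w') * (2 * N (lsubmx w') (rsubmx w'))^-1.
  move=> sw'; rewrite /dy FN (derive_lblock N).
  have dA : is_derive (lsubmx w') (delta_mx 0 i)
      (fun y => sq L1 x1 y + phi x * sq L2 x2 (rsubmx w'))
      (dy i (sq L1) x1 (lsubmx w')).
    apply: (is_derive_eq_line (f := sq L1 x1)).
      by move=> h /=; rewrite opprD addrACA subrr addr0.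
    apply/derivableP/diff_derivable.
    by apply: (differentiable_fibre (smooth_sq fL1)); split; [exact: Ux.1|exact: sw'.1].
  by have [_ ->] := is_derive_sqrt_comp dA (N2_gt0 _ _ sw'.1 sw'.2).
move=> sw; have N0 : F x w != 0 by rewrite FN gt_eqF// N_gt0// ?sw.1 ?sw.2.
rewrite /angular_metric mulKf// {1}/dy (derive_eq_on _ oslit sw (g := fun w =>
  dy i (sq L1) x1 (lsubmx w) * (2 * N (lsubmx w) (rsubmx w))^-1)); last first.
  by move=> z; rewrite inE; exact: d1.
rewrite (derive_rblock (fun y v => dy i (sq L1) x1 y * (2 * N y v)^-1)).
rewrite deriveZ_total.
have dB : is_derive (rsubmx w) (delta_mx 0 a)
    (fun v => sq L1 x1 (lsubmx w) + phi x * sq L2 x2 v)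
    (phi x * dy a (sq L2) x2 (rsubmx w)).
  apply: (is_derive_eq_line (f := fun v => phi x * sq L2 x2 v)).
    by move=> h /=; rewrite opprD addrACA subrr add0r.
  rewrite /dy -deriveZ_total; apply/derivableP/derivableZ/diff_derivable.
  by apply: (differentiable_fibre (smooth_sq fL2)); split; [exact: Ux.2|exact: sw.2].
have [dN NE] := is_derive_sqrt_comp dB (N2_gt0 _ _ sw.1 sw.2).
rewrite FN in N0 *.
rewrite (@deriveV _ _ (fun v => 2 * N (lsubmx w) v)) ?mulf_neq0 ?pnatr_eq0//; last first.
  exact: (derivableZ dN).
rewrite deriveZ_total NE -/(N _ _) -[_ *: _]/(_ * _).
by field.
Qed.

(** [C] stands for the whole factor [(n + 1) c / 2] at the base point. Along the vectors [(y, t v)],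
    [K(y)] stays fixed while [F] varies. *)
Lemma twisted_isotropic_eq0 (C : R) w : slit w ->
  (forall t : R, 0 < t -> forall j k,
    let w' := row_mx (lsubmx w) (t *: rsubmx w) in
    mean_berwald F j k x w' = C * (F x w')^-1 * angular_metric F j k x w') ->
  C = 0.
Proof.
move=> [w1 w2] E; apply: contrapT => /eqP C0.
have [i Ai] := ex_dy_sq_neq0 fL1 Ux.1 w1.
have [a Ba] := ex_dy_sq_neq0 fL2 Ux.2 w2.
have [K KE] := mean_berwald_twisted i a.
pose w' := row_mx (lsubmx w) (2 *: rsubmx w).
have sw' : slit w'.
  by rewrite /slit/= row_mxKl row_mxKr scaler_eq0 negb_or w1 pnatr_eq0.
have phi0 := phi_gt0 _ Ux.
have B0 := sq_gt0 fL2 Ux.2 w2.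
have F0 z : slit z -> 0 < F x z.
  move=> [z1 z2]; rewrite FE// sqrtr_gt0 addr_gt0 ?(sq_gt0 fL1 Ux.1 z1)//.
  by rewrite mulr_gt0// (sq_gt0 fL2 Ux.2 z2).
(* The common factor [B_a] cancels, as by homogeneity it stays nonzero at [t v]. The left side is
   free of [t]. *)
have K_eq (t : R) : 0 < t -> let w' := row_mx (lsubmx w) (t *: rsubmx w) in
    K (lsubmx w) = - C * phi x * dy i (sq L1) x1 (lsubmx w) / 4 / F x w' ^+ 3.
  move=> t0 z; have zw : lsubmx z = lsubmx w by rewrite row_mxKl.
  have sz : slit z.
    by rewrite /slit/= row_mxKl row_mxKr scaler_eq0 negb_or w1 w2 gt_eqF.
  have Bz : dy a (sq L2) x2 (rsubmx z) != 0.
    by rewrite row_mxKr (dy_sq_homogeneous fL2 Ux.2 w2)// mulf_neq0// gt_eqF.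
  have := E t t0 (lshift n2 i) (rshift n1 a).
  rewrite /= -/z KE// zw -mulrA angular_metric_twisted// zw => KB.
  apply: (mulIf Bz); rewrite KB; field.
  by rewrite gt_eqF// F0.
(* Compare [t = 1] with [t = 2]; the remaining factors are nonzero because [C], [phi] and [A_i]
   are. *)
have F3 : F x w ^+ 3 = F x w' ^+ 3.
  have := K_eq 1 ltr01; rewrite /= scale1r hsubmxK (K_eq 2)//= -/w'.
  move=> /mulfI e; apply/esym/invr_inj/e.
  by rewrite !mulf_neq0 ?oppr_eq0// ?gt_eqF// invr_gt0 ltr0n.
have F1 : F x w = F x w'.
  by apply: (pexpIrn (n := 3)) => //; rewrite nnegrE ltW// F0.
have : sq F x w = sq F x w' by rewrite /sq F1.
(* The equality reads [A + phi B = A + 4 phi B], against [phi B > 0]. *)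
rewrite !sq_twisted// row_mxKl row_mxKr (sq_homogeneous fL2 Ux.2)//.
by have := mulr_gt0 phi0 B0; lra.
Qed.

End twisted_product.

(** * Passage from charts to the local computation *)

Section manifolds.
Context {R : realType}.

(** The preferred chart contains the point, so [x] lies in the image of the overlap, where the
    transition is smooth. *)
Lemma differentiable_transition {n : nat} {M : manifold R n} (i : charts M) x :
  chart_image i x ->
  differentiable (transition i (chart_at (chart_inv i x))) x.
Proof.
move=> ix; apply: (@transition_smooth _ _ M i (chart_at (chart_inv i x)) 1%N).1.
by rewrite image_chartI; split => //; exact: chart_atP.
Qed.

Lemma finsler_on_local_expr {n : nat} {M : manifold R n} {F : M -> 'rV[R]_n -> R}
    (i : charts M) :
  finsler_metric F -> finsler_on (chart_image i) (local_expr F i).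
Proof.
move=> fF; split.
- exact: chart_imageO.
- exact: finsler_smooth fF i.
- by move=> x t y ix t0; rewrite /local_expr /to_tangent linearZ /=
    (finsler_homogeneous fF).
- by move=> x y v; exact: finsler_posdef fF i x y v.
Qed.

Lemma chart_image_product {n1 n2 : nat} {M1 : manifold R n1} {M2 : manifold R n2}
    (i : charts (product_manifold M1 M2)) x : chart_image i x =
  (chart_image i.1 (lsubmx x) /\ chart_image i.2 (rsubmx x)).
Proof. exact: (congr1 (fun A : set _ => A x) (prod_imageE i)). Qed.

(** Preferred charts of the product are products of preferred charts, so the transition map and its
    differential act block by block. *)
Lemma to_tangent_product {n1 n2 : nat} {M1 : manifold R n1} {M2 : manifold R n2}
    (i : charts (product_manifold M1 M2)) x w : chart_image i x ->
  to_tangent i x w = row_mx (to_tangent i.1 (lsubmx x) (lsubmx w))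
                            (to_tangent i.2 (rsubmx x) (rsubmx w)).
Proof.
rewrite chart_image_product => -[ix1 ix2].
have d1 := differentiableP (differentiable_transition i.1 _ ix1).
have d2 := differentiableP (differentiable_transition i.2 _ ix2).
have [_ dE] := is_diff_row_mx (is_diff_comp (is_diff_lsubmx x) d1)
  (is_diff_comp (is_diff_rsubmx x) d2).
exact: (congr1 (fun d => d w) dE).
Qed.

End manifolds.

Theorem theorem10 (R : realType) (n1 n2 : nat)
  (M1 : manifold R n1) (M2 : manifold R n2)
  (F1 : M1 -> 'rV[R]_n1 -> R) (F2 : M2 -> 'rV[R]_n2 -> R)
  (F1_finsler : finsler_metric F1) (F2_finsler : finsler_metric F2)
  (f : product_manifold M1 M2 -> R)
  (f_pos : forall p : product_manifold M1 M2, 0 < f p)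
  (f_smooth : smooth_function f) :
  isotropic_mean_berwald (twisted_domain M1 M2) (twisted_product F1 F2 f) ->
  weakly_berwald (twisted_domain M1 M2) (twisted_product F1 F2 f).
Proof.
move=> [c iso] i x w ix Dw j k; rewrite iso//.
suff -> : c (chart_inv i x) = 0 by rewrite mulr0 !mul0r.
(* [to_tangent] is linear in each block, so a nonzero image comes from a nonzero component. *)
have Dw' : lsubmx w != 0 /\ rsubmx w != 0.
  move: Dw; rewrite /twisted_domain /= to_tangent_product// row_mxKl row_mxKr.
  by move=> [w1 w2]; split; [apply: contraNneq w1|apply: contraNneq w2] => ->;
    rewrite /to_tangent linear0.
(* The constant [(n1 + n2 + 1) / 2] is nonzero, so it can be absorbed with [c] into the [C] of the
   local statement. *)
suff C0 : 2^-1 * (n1 + n2 + 1)%:R * c (chart_inv i x) = 0.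
  by move: C0 => /eqP; rewrite !mulf_eq0 invr_eq0 !pnatr_eq0 addn1 => /eqP.
apply: (@twisted_isotropic_eq0 _ _ _ _ (local_expr F1 i.1) _ (local_expr F2 i.2)
  (finsler_on_local_expr i.1 F1_finsler) (finsler_on_local_expr i.2 F2_finsler)
  (fun z => f (chart_inv i z) ^+ 2) _ _ (local_expr (twisted_product F1 F2 f) i)
  _ x _ _ w Dw').
- by move=> z _; rewrite exprn_gt0.
- move=> z; rewrite /= -chart_image_product => iz.
  have dfz := (f_smooth i 1%N).1 z iz.
  exact: (differentiableM dfz dfz).
- move=> z v; rewrite /= -chart_image_product => iz; rewrite {1}/local_expr /twisted_product.
  by rewrite to_tangent_product// row_mxKl row_mxKr.
- by rewrite /= -chart_image_product.
(* Scaling the second component by [t > 0] keeps the vector in the domain over the same base point,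
   so the same value of [c] applies. *)
- move=> t t0 j' k' /=; apply: iso => //.
  move: Dw; rewrite /twisted_domain /= !to_tangent_product// !row_mxKl !row_mxKr.
  by move=> [w1 w2]; split => //; rewrite /to_tangent linearZ /= scaler_eq0 negb_or w2 gt_eqF.
Qed.
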